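(* Let $X$ be a finite pure simplicial complex of dimension $d\in\mathbb{N}$ with $n\geq 1$ vertices. The following are equivalent: (1) $X$ is linearly shellable; (2) there exists a bijection $\sigma:V(X)\to[n]$ such that, for the induced injective map $\sigma_X:X\to[n]^{d+1}_<$, the lexicographic order on $\operatorname{im}(\sigma_X)$ is a shelling order; (3) there exists a bijection $\sigma:V(X)\to[n]$ such that, for the induced map $\sigma_X:X\to[n]^{d+1}_<$, every linear extension of the poset $\operatorname{im}(\sigma_X)$ (with the Bruhat order) is a shelling order.
   Context: $[n]=\{1,\dots,n\}$. $[n]^k_<$ is the set of strictly increasing $k$-tuples $x=(x_1<\dots<x_k)$ with entries in $[n]$, identified with $k$-element subsets of $[n]$; it carries the Bruhat (Gale) order: $x\le y$ iff $x_i\le y_i$ for all $i\in[k]$. The lexicographic order $<_{lex}$ on $[n]^k_<$ is a linear extension of it. A pure simplicial complex is identified with its set of facets; a bijection $\sigma:V(X)\to[n]$ sends each facet (a $(d+1)$-set of vertices) to an element of $[n]^{d+1}_<$, giving $\sigma_X$, and $\operatorname{im}(\sigma_X)$ is an induced subposet of $[n]^{d+1}_<$. A linear extension of a finite poset $P$ with $|P|=h$ is a listing $(C_1,\dots,C_h)$ of its elements such that $C_i<C_j$ implies $i<j$. A sequence $(C_1,\dots,C_h)$ of distinct elements of $[n]^k_<$ is a shelling order if for all $i<j$ in $[h]$ there exists $r<j$ with $C_r=C_j+\{a,b\}$ (symmetric difference), where $a\in C_j\setminus C_i$ and $b\in C_r\setminus C_j$. $X$ is linearly shellable if there exists a bijection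 $\sigma:V(X)\to[n]$ such that the induced subposet $\operatorname{im}(\sigma_X)\subseteq[n]^{d+1}_<$ has a linear extension which is a shelling order. *)

(* Defs.v *)
From HB Require Import structures.
From mathcomp Require Import all_boot all_order.

Set Implicit Arguments.
Unset Strict Implicit.
Unset Printing Implicit Defensive.

Import Order.TTheory.

(* [incr_tuple n k] is [n]^k_<.  The ground set [n] = {1, ..., n} is
   represented by 'I_n = {0, ..., n - 1} with its usual order. *)
Record incr_tuple (n k : nat) := IncrTuple {
  incr_val :> k.-tuple 'I_n;
  incr_valP : sorted (fun i j : 'I_n => i < j) incr_val
}.

HB.instance Definition _ n k := [isSub for @incr_val n k].
HB.instance Definition _ n k := [Finite of incr_tuple n k by <:].

Definition supp n k (x : incr_tuple n k) : {set 'I_n} := [set i in val x].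

Definition bruhat_le n k (x y : incr_tuple n k) : bool :=
  [forall i : 'I_k, tnth (val x) i <= tnth (val y) i].

Lemma bruhat_refl n k : reflexive (@bruhat_le n k).
Proof. by move=> x; apply/forallP. Qed.

Lemma bruhat_anti n k : antisymmetric (@bruhat_le n k).
Proof.
move=> x y /andP[/forallP xy /forallP yx]; apply/val_inj/eq_from_tnth => i.
by apply/val_inj/eqP; rewrite eqn_leq xy yx.
Qed.

Lemma bruhat_trans n k : transitive (@bruhat_le n k).
Proof.
move=> y x z /forallP xy /forallP yz; apply/forallP => i.
exact: leq_trans (xy i) (yz i).
Qed.

Fact bruhat_display : Order.disp_t. Proof. exact: Order.Disp tt tt. Qed.

HB.instance Definition _ n k :=
  Order.Le_isPOrder.Build bruhat_display (incr_tuple n k)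
    (@bruhat_refl n k) (@bruhat_anti n k) (@bruhat_trans n k).

Definition lex_le n k (x y : incr_tuple n k) : bool :=
  ((val x : k.-tuplelexi 'I_n) <= (val y : k.-tuplelexi 'I_n))%O.

Definition lex_listing n k (P : {set incr_tuple n k}) :
    #|P|.-tuple (incr_tuple n k) :=
  [tuple of sort (@lex_le n k) (enum P)].

(* [C] lists the elements of the subposet [P] without repetition. *)
Definition linear_extension (disp : Order.disp_t) (T : finPOrderType disp)
    (P : {set T}) (C : #|P|.-tuple T) : Prop :=
  [/\ uniq C, C =i P &
      forall i j : 'I_#|P|, (tnth C i < tnth C j)%O -> i < j].

Definition symdiff (T : finType) (A B : {set T}) : {set T} :=
  (A :\: B) :|: (B :\: A).

Definition shelling_order n k h (C : h.-tuple (incr_tuple n k)) : Prop :=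
  uniq C /\
  forall i j : 'I_h, i < j ->
    exists r : 'I_h, r < j /\
    exists a b : 'I_n,
      [/\ a \in supp (tnth C j) :\: supp (tnth C i),
          b \in supp (tnth C r) :\: supp (tnth C j) &
          supp (tnth C r) = symdiff (supp (tnth C j)) [set a; b]].

(* The vertex set V(X) is the whole finite type [V]. *)
Record simplicial_complex (V : finType) := SimplicialComplex {
  faces : {set {set V}};
  faces_down : forall F G : {set V}, F \in faces -> G \subset F -> G \in faces;
  faces_vertex : forall v : V, [set v] \in faces
}.

Definition facets (V : finType) (X : simplicial_complex V) : {set {set V}} :=
  [set F | maxset (fun G => G \in faces X) F].

Definition pure_dim (V : finType) (X : simplicial_complex V) (d : nat) : Prop :=
  forall F, F \in facets X -> #|F| = d.+1.

Definition facet (V : finType) (X : simplicial_complex V) :=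
  {F : {set V} | F \in facets X}.

Lemma size_enum_set n k (A : {set 'I_n}) : #|A| = k -> size (enum A) == k.
Proof. by rewrite cardE => ->. Qed.

Lemma sorted_enum_set n (A : {set 'I_n}) :
  sorted (fun i j : 'I_n => i < j) (enum A).
Proof.
rewrite /enum_mem; apply: sorted_filter.
  by move=> j i l; apply: ltn_trans.
have := iota_ltn_sorted 0 n.
by rewrite -val_enum_ord sorted_map enumT.
Qed.

(* The increasing listing of a [k]-element subset: [enum] lists 'I_n in
   increasing order. *)
Definition incr_of_set n k (A : {set 'I_n}) (cardA : #|A| = k) :
    incr_tuple n k :=
  IncrTuple (incr_val := Tuple (size_enum_set cardA)) (sorted_enum_set A).

Lemma incr_of_setK n k (A : {set 'I_n}) (cardA : #|A| = k) :
  supp (incr_of_set cardA) = A.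
Proof. by apply/setP => i; rewrite inE mem_enum. Qed.

Lemma card_facet_image (V : finType) (X : simplicial_complex V) (d n : nat)
    (pureX : pure_dim X d) (sigma : V -> 'I_n) (sigma_bij : bijective sigma)
    (F : facet X) :
  #|sigma @: val F| = d.+1.
Proof.
by rewrite (card_imset _ (bij_inj sigma_bij)); apply: pureX (valP F).
Qed.

(* sigma_X : X -> [n]^(d+1)_< *)
Definition facet_map (V : finType) (X : simplicial_complex V) (d n : nat)
    (pureX : pure_dim X d) (sigma : V -> 'I_n) (sigma_bij : bijective sigma)
    (F : facet X) : incr_tuple n d.+1 :=
  incr_of_set (card_facet_image pureX sigma_bij F).

Lemma facet_map_inj (V : finType) (X : simplicial_complex V) (d n : nat)
    (pureX : pure_dim X d) (sigma : V -> 'I_n) (sigma_bij : bijective sigma) :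
  injective (facet_map pureX sigma_bij).
Proof.
move=> F G /(congr1 (@supp _ _)); rewrite !incr_of_setK.
by move/(imset_inj (bij_inj sigma_bij))/val_inj.
Qed.

Definition facet_im (V : finType) (X : simplicial_complex V) (d n : nat)
    (pureX : pure_dim X d) (sigma : V -> 'I_n) (sigma_bij : bijective sigma) :
    {set incr_tuple n d.+1} :=
  [set facet_map pureX sigma_bij F | F : facet X].

Definition linearly_shellable (V : finType) (X : simplicial_complex V)
    (d n : nat) (pureX : pure_dim X d) : Prop :=
  exists (sigma : V -> 'I_n) (sigma_bij : bijective sigma),
  exists C : #|facet_im pureX sigma_bij|.-tuple (incr_tuple n d.+1),
    linear_extension C /\ shelling_order C.

(* Main.v *)
Require Import Defs.
From mathcomp Require Import all_boot all_order.

Set Implicit Arguments.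
Unset Strict Implicit.
Unset Printing Implicit Defensive.

Import Order.TTheory.

(** Two sets differing by one exchange are Bruhat comparable, so a linear
    extension [C] of a subposet [P] is a shelling order iff for all [i < j] the
    pair [(C_i, C_j)] satisfies a condition [descends P] that does not mention
    [C].  If some linear extension is a shelling order, then [descends P x y]
    holds whenever [y] is not below [x]: if [x] comes after [y], shelling yields
    an exchange [x' < x] of [x] in [P] removing an element outside [y]; then
    [y \ x'] is contained in [y \ x], and one concludes by induction on [x].
    Every linear extension is then a shelling order. *)

Section Bruhat.
Variables n k : nat.
Implicit Types (x y z : incr_tuple n k) (P : {set incr_tuple n k}).

Lemma incr_tnth_ltn x (i j : 'I_k) : (tnth x i < tnth x j) = (i < j).
Proof.
have mono (u v : 'I_k) : u < v -> tnth x u < tnth x v.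
  move=> uv; have x0 := tnth x i; rewrite !(tnth_nth x0).
  apply: (sorted_ltn_nth _ _ (incr_valP x)); rewrite ?inE ?size_tuple //.
  by move=> b a c; apply: ltn_trans.
case: (ltngtP i j) => [/mono//|/mono/ltnW|/val_inj->]; last by rewrite ltnn.
by rewrite ltnNge => ->.
Qed.

Lemma symdiff2E (A : {set 'I_n}) a b : a \in A -> b \notin A ->
  symdiff A [set a; b] = b |: A :\ a.
Proof.
move=> aA bA; apply/setP=> c; rewrite !inE.
have [->|ca] := eqVneq c a; last have [->|cb] := eqVneq c b.
- by rewrite aA /=; case: eqVneq bA => // <-; rewrite aA.
- by rewrite (negPf bA) orbT.
- by case: (c \in A).
Qed.

Lemma exchange_lt y z a b : a \in supp y -> b \notin supp y ->
  supp z = b |: supp y :\ a -> b < a -> (z < y)%O.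
Proof.
move=> ay by_ zE ba; rewrite lt_neqAle; apply/andP; split.
  by apply: contraNneq by_ => <-; rewrite zE setU11.
apply/forallP=> i; rewrite leqNgt; apply/negP=> yz.
(* [f] carries [supp y] injectively into [supp z] and, as [b < a], never increases an element. *)
pose f c := if c == a then b else c.
have f_inj : {in supp y &, injective f}.
  move=> c c' cy c'y; rewrite /f.
  case: eqVneq => [->|_]; case: eqVneq => [->|_] // e.
    by rewrite e c'y in by_.
  by rewrite -e cy in by_.
have tsupp x (j : 'I_k) : tnth x j \in supp x by rewrite inE mem_tnth.
have tinj x : injective (tnth x).
  move=> j j' e; case: (ltngtP j j') => [||/val_inj//];
    by rewrite -(incr_tnth_ltn x) e ltnn.
(* [f] sends the [i + 1] smallest elements of [y] to elements of [z] below
   [z_i], of which there are only [i]. *)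
have sub : [set f (tnth y j) | j : 'I_k & j <= i] \subset
           [set tnth z j | j : 'I_k & j < i].
  apply/subsetP=> c /imsetP[j]; rewrite inE => ji -> {c}.
  have fz : f (tnth y j) \in supp z.
    rewrite zE in_setU1 in_setD1 /f.
    by case: (eqVneq (tnth y j) a) => [_|->]; rewrite ?eqxx // tsupp orbT.
  have fle : f (tnth y j) <= tnth y j.
    by rewrite /f; case: eqVneq => // ->; apply: ltnW.
  have flt : f (tnth y j) < tnth z i.
    apply: leq_ltn_trans fle (leq_ltn_trans _ yz).
    by rewrite leqNgt incr_tnth_ltn -leqNgt.
  move: fz; rewrite inE => /tnthP[l el]; rewrite el; apply: imset_f.
  by rewrite inE -(incr_tnth_ltn z) -el.
have := subset_leq_card sub.
rewrite !card_in_imset; first last.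
- by move=> j j' _ _ e; apply/(tinj y)/f_inj.
- by move=> j j' _ _ /tinj.
rewrite [X in X <= _](_ : _ = #|i |: [set j : 'I_k | j < i]|).
  by rewrite cardsU1 inE ltnn add1n ltnn.
by apply: eq_card => j; rewrite !inE leq_eqVlt.
Qed.

(** Here [b < a] stands in for the requirement that [z] be listed before [y]: by [exchange_lt] it
    forces [z < y]. *)
Definition descends P x y := exists z a b,
  [/\ z \in P, a \in supp y :\: supp x, b \notin supp y, b < a &
      supp z = b |: supp y :\ a].

(** If [a < b], undoing the exchange would put [C_j] below [C_r], so a linear extension would list
    [C_j] first, against [r < j]. *)
Lemma shelling_descends P (C : #|P|.-tuple (incr_tuple n k)) :
  linear_extension C -> shelling_order C ->
  forall i j : 'I_#|P|, i < j -> descends P (tnth C i) (tnth C j).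
Proof.
move=> [_ CP Cext] [_ Csh] i j /Csh[r [rj [a [b [aD bD zE]]]]].
have [/setDP[aj ai] /setDP[br bj]] := (aD, bD).
have zE' := zE; rewrite symdiff2E // in zE'.
exists (tnth C r), a, b; split=> //; first by rewrite -CP mem_tnth.
case: (ltngtP b a) => // [ab|/val_inj ab]; last by rewrite ab aj in bj.
have yE : supp (tnth C j) = a |: supp (tnth C r) :\ b.
  rewrite zE' setU1K ?setD1K // !inE negb_and.
  by move: bj; rewrite inE => ->; rewrite orbT.
have ar : a \notin supp (tnth C r).
  by rewrite zE' in_setU1 setD11 orbF; apply: contraNneq bj => <-.
have := Cext _ _ (exchange_lt br ar yE ab).
by rewrite ltnNge (ltnW rj).
Qed.

Lemma shelling_descends_nle P (C : #|P|.-tuple (incr_tuple n k)) :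
  linear_extension C -> shelling_order C ->
  forall x y, x \in P -> y \in P -> ~~ (y <= x)%O -> descends P x y.
Proof.
move=> Cext Csh x y xP yP.
have [_ CP Cmono] := Cext.
move: xP yP; rewrite -!CP => /tnthP[i ->] /tnthP[j ->] {x y}.
(* Induction on the position of [x] in [C]; the exchange [x'] lies below [x], hence occurs
   earlier. *)
have [m] := ubnP (val i); elim: m i => // m IH i; rewrite ltnS => im yx.
case: (ltngtP i j) => [|ji|/val_inj eij]; first exact: shelling_descends.
  have [x' [a [b [x'P /setDP[ai aj] bi ba x'E]]]] :=
    shelling_descends Cext Csh ji.
  have x'x := exchange_lt ai bi x'E ba.
  move: x'P; rewrite -CP => /tnthP[l el].
  rewrite el in x'x x'E.
  have yx' : ~~ (tnth C j <= tnth C l)%O.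
    by apply: contra yx => /le_trans; apply; apply: ltW.
  have [z [c [e [zP /setDP[cj cl] ej ec zE]]]] :=
    IH l (leq_trans (Cmono _ _ x'x) im) yx'.
  (* The exchange found for [x'] also serves [x]: [c] lies in [y] and [a] does not, so [c] differs
     from [a], and [c] in [x] would give [c] in [x']. *)
  exists z, c, e; split=> //; rewrite in_setD cj andbT.
  apply: contra cl => ci; rewrite x'E in_setU1 in_setD1 ci andbT.
  by apply/orP; right; apply: contraNneq aj => <-.
by rewrite eij lexx in yx.
Qed.

Lemma descends_shelling P (C : #|P|.-tuple (incr_tuple n k)) :
  (forall x y, x \in P -> y \in P -> ~~ (y <= x)%O -> descends P x y) ->
  linear_extension C -> shelling_order C.
Proof.
move=> desc [Cu CP Cmono]; split=> // i j ij.
(* A later term of a linear extension is never below an earlier one. *)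
have yx : ~~ (tnth C j <= tnth C i)%O.
  rewrite le_eqVlt negb_or; apply/andP; split.
    by apply: contraTneq ij => /(tuple_uniqP _ Cu)->; rewrite ltnn.
  by apply: contraL ij => /Cmono/ltnW; rewrite leqNgt.
have CP_ l : tnth C l \in P by rewrite -CP mem_tnth.
have [z [a [b [zP aD bj ba zE]]]] := desc _ _ (CP_ i) (CP_ j) yx.
have /setDP[aj _] := aD.
have zy := exchange_lt aj bj zE ba.
move: zP; rewrite -CP => /tnthP[r er]; rewrite er in zy zE.
exists r; split; first exact: Cmono.
exists a, b; split=> //; last by rewrite symdiff2E.
by rewrite in_setD bj zE setU11.
Qed.

Lemma shelling_linear_extensions P (C D : #|P|.-tuple (incr_tuple n k)) :
  linear_extension C -> shelling_order C ->
  linear_extension D -> shelling_order D.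
Proof.
move=> Cext Csh; exact: descends_shelling (shelling_descends_nle Cext Csh).
Qed.

Lemma bruhat_lex x y : (x <= y)%O -> lex_le x y.
Proof.
move=> xy; have /forallP xy_tnth : bruhat_le x y := xy.
by apply: (sub_tprod_lexi _ (d := Order.Disp tt tt)); rewrite leEtprod; apply/forallP.
Qed.

Lemma lex_listing_linear_extension P : linear_extension (lex_listing P).
Proof.
have lex_total : total (@lex_le n k) by move=> x y; apply: le_total.
have lex_tr : transitive (@lex_le n k) by move=> y x z; apply: le_trans.
have lex_anti : antisymmetric (@lex_le n k).
  by move=> x y xy; apply/val_inj/(@le_anti _ (k.-tuplelexi 'I_n)).
split=> [|x|i j ltij].
- by rewrite sort_uniq enum_uniq.
- by rewrite mem_sort mem_enum.
(* If [j <= i], sorting gives one lexicographic inequality and the Bruhat order the opposite one, so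
   the two terms coincide. *)
rewrite ltnNge; apply/negP=> ji; move: ltij.
have lexji : lex_le (tnth (lex_listing P) j) (tnth (lex_listing P) i).
  have x0 := tnth (lex_listing P) i; rewrite !(tnth_nth x0).
  apply: (sorted_leq_nth lex_tr) => //.
  - by move=> x; apply: lexx.
  - exact: sort_sorted.
  - by rewrite inE size_tuple.
  - by rewrite inE size_tuple.
rewrite lt_neqAle => /andP[/eqP neq /bruhat_lex lexij]; apply: neq.
by apply: lex_anti; rewrite lexij lexji.
Qed.

End Bruhat.

Theorem theorem3p2 (V : finType) (X : simplicial_complex V) (d n : nat)
    (pureX : pure_dim X d) (cardV : #|V| = n) (n_ge1 : 1 <= n) :
  [<-> linearly_shellable n pureX;
       exists (sigma : V -> 'I_n) (sigma_bij : bijective sigma),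
         shelling_order (lex_listing (facet_im pureX sigma_bij));
       exists (sigma : V -> 'I_n) (sigma_bij : bijective sigma),
         forall C : #|facet_im pureX sigma_bij|.-tuple (incr_tuple n d.+1),
           linear_extension C -> shelling_order C].
Proof.
tfae.
- move=> [sigma [sigma_bij [C [Cext Csh]]]]; exists sigma, sigma_bij.
  exact: shelling_linear_extensions Cext Csh (lex_listing_linear_extension _).
- move=> [sigma [sigma_bij lexsh]]; exists sigma, sigma_bij => C.
  exact: shelling_linear_extensions (lex_listing_linear_extension _) lexsh.
- move=> [sigma [sigma_bij allsh]]; exists sigma, sigma_bij.
  have lexext := lex_listing_linear_extension (facet_im pureX sigma_bij).
  (* The universal statement needs some linear extension to act on; the lexicographic listing is
     one. *)
  by exists (lex_listing _); split; last exact: allsh.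
Qed.
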